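(* Let $(V,\Upsilon(z),c,\rho)$ be a graded vertex operator coalgebra, and let $V'$ be its dual vertex operator algebra. (i) $g$ is an automorphism of $V$ if and only if $g$ is an automorphism of $V'$. (ii) $\phi$ is a derivation of $V$ if and only if $\phi$ is a derivation of $V'$. Here $g$ is understood to act on $V'$ by $(g(v^* ),v)=(v^*,g^{-1}(v))$, and $\phi$ by $(\phi(v^* ),v)=(v^*,-\phi(v))$, for $v^*\in V'$, $v\in V$.
   Context: All vector spaces and linear maps are over $\mathbb C$; $(\cdot,\cdot)$ is the natural pairing between a space and its dual; $\tau(v\otimes w)=w\otimes v$; $(z_1+z_2)^n$ is expanded in nonnegative powers of $z_2$; $\delta(x)=\sum_{n\in\mathbb Z}x^n$. Graded vertex operator coalgebra $(V,\Upsilon(z),c,\rho)$: $V=\bigoplus_{s\in\mathbb Z}V_s$, $\dim V_s<\infty$, $V_s=0$ for $s\ll0$; linear maps $c,\rho:V\to\mathbb C$ and $\Upsilon(z):V\to(V\otimes V)[[z,z^{-1}]]$, $\Upsilon(z)v=\sum_{k\in\mathbb Z}\Delta_k(v)z^{-k-1}$, with: (1) $\Delta_k(v)=0$ for $k\ll0$ and $\Delta_k(V_s)\subseteq(V\otimes V)_{s+k+1}$; (2) $(c\otimes\mathrm{Id})\Upsilon(z)v=v$, and $(\mathrm{Id}\otimes c)\Upsilon(z)v\in V[[z]]$ with constant term $v$; (3) the Jacobi identity $z_0^{-1}\delta(\frac{z_1-z_2}{z_0})(\mathrm{Id}\otimes\Upsilon(z_2))\Upsilon(z_1)-z_0^{-1}\delta(\frac{z_2-z_1}{-z_0})(\tau\otimes\mathrm{Id})(\mathrm{Id}\otimes\Upsilon(z_1))\Upsilon(z_2)=z_1^{-1}\delta(\frac{z_2+z_0}{z_1})(\Upsilon(z_0)\otimes\mathrm{Id})\Upsilon(z_2)$;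 (4) writing $(\rho\otimes\mathrm{Id})\Upsilon(z)=\sum_kL(k)z^{k-2}$, the operators $L(k)\in\mathrm{End}(V)$ satisfy $[L(k),L(j)]=(k-j)L(k+j)+\frac{k^3-k}{12}\delta_{k+j,0}d$ for a constant $d$, $V_s$ is the $s$-eigenspace of $L(0)$, and $(L(1)\otimes\mathrm{Id})\Upsilon(z)=\frac{d}{dz}\Upsilon(z)$. An automorphism of $V$ is a linear bijection $g:V\to V$ with $c\circ g=c$, $\rho\circ g=\rho$, $\Upsilon(z)\circ g=(g\otimes g)\circ\Upsilon(z)$. A derivation of $V$ is a linear map $\phi:V\to V$ with $c\circ\phi=\rho\circ\phi=0$ and $\Upsilon(z)\circ\phi=(\phi\otimes\mathrm{Id})\circ\Upsilon(z)+(\mathrm{Id}\otimes\phi)\circ\Upsilon(z)$. A vertex operator algebra $(\mathcal V,Y,\mathbf 1,\omega)$ is taken in the usual sense ($\mathbb Z$-graded by $L(0)$-eigenvalues with finite-dimensional homogeneous spaces, grading bounded below, vacuum $\mathbf 1\in\mathcal V_0$, conformal vector $\omega\in\mathcal V_2$). An automorphism of it is a linear bijection $g$ with $g(\mathbf 1)=\mathbf 1$, $g(\omega)=\omega$, $g(Y(u,z)v)=Y(g(u),z)g(v)$; a derivation is a linear map $\phi$ with $\phi(\mathbf 1)=\phi(\omega)=0$ and $\phi(Y(u,z)v)=Y(\phi(u),z)v+Y(u,z)\phi(v)$. Dual: $V'=\bigoplus_sV_s^*$ carries the vertex operator algebra structure $\mathbf 1=c|_{V_0}$, $\omega=\rho|_{V_2}$,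 $(Y(u^*,z)v^*,v)=(u^*\otimes v^*,\Upsilon(z)v)$ for $u^*,v^*\in V'$, $v\in V$ (the duality result giving this structure is stated for $V_0\not\subseteq\ker c$ and $V_2\not\subseteq\ker\rho$). *)

(* Defs.v *)
From HB Require Import structures.
From mathcomp Require Import all_boot all_order all_algebra generic_quotient finmap.
From mathcomp Require Import boolp classical_sets functions cardinality fsbigop.
From mathcomp Require Import reals complex.
From mathcomp Require Import zify.

(* Vertex operator coalgebras, vertex operator algebras, and the vertex operator
   algebra structure on the restricted dual of a vertex operator coalgebra.
   Everything is developed over a field K with K : numFieldType (characteristic
   zero); the intended K is the field of complex numbers.

   A formal series in X[[z,z^-1]] is its coefficient function int -> X, and a
   series in z0, z1, z2 is a function int * int * int -> X; the argument is the
   exponent. *)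

Set Implicit Arguments.
Unset Strict Implicit.
Unset Printing Implicit Defensive.

Import Order.TTheory GRing.Theory Num.Theory.

Local Open Scope classical_set_scope.
Local Open Scope ring_scope.
Local Open Scope quotient_scope.

Notation bilin F := (bilinear_for *:%R *:%R F).

Section Tensor.
Variables (K : numFieldType) (U W : lmodType K).

(* A list of pairs stands for the sum of the corresponding pure tensors. Two such
   sums are identified when no bilinear map can tell them apart, which gives the
   algebraic tensor product together with its universal property. *)
Definition fsum_eval (X : lmodType K) (F : U -> W -> X) (l : seq (U * W)) : X :=
  \sum_(p <- l) F p.1 p.2.

Definition tens_rel : rel (seq (U * W)) := fun l1 l2 =>
  `[< forall (X : lmodType K) (F : U -> W -> X),
        bilin F -> fsum_eval F l1 = fsum_eval F l2 >].

Lemma tens_rel_equiv : equiv_class_of tens_rel.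
Proof.
split.
- by move=> l; apply/asboolP.
- by move=> l1 l2; apply/asboolP/asboolP => h X F bF; rewrite h.
- by move=> l2 l1 l3 /asboolP h1 /asboolP h2; apply/asboolP => X F bF; rewrite h1 ?h2.
Qed.

Canonical tens_equiv := EquivRelPack tens_rel_equiv.

Definition tensor := {eq_quot tens_equiv}.
HB.instance Definition _ := Choice.on tensor.
HB.instance Definition _ := EqQuotient.on tensor.

(* For a bilinear F this is the linear map it induces (tlift_is_linear, tlift_tens);
   for other F the value depends on the chosen representative and is junk. *)
Definition tlift (X : lmodType K) (F : U -> W -> X) (x : tensor) : X :=
  fsum_eval F (repr x).

Lemma tliftE X F l : bilin F -> @tlift X F (\pi_tensor l) = fsum_eval F l.
Proof.
move=> bF; rewrite /tlift.
have := reprK (\pi_tensor l); move/eqmodP => /asboolP; exact.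
Qed.

Lemma tens_eqP l1 l2 :
  (forall (X : lmodType K) (F : U -> W -> X), bilin F -> fsum_eval F l1 = fsum_eval F l2) ->
  \pi_tensor l1 = \pi_tensor l2.
Proof. by move=> h; apply/eqmodP/asboolP. Qed.

Lemma tens_ext (x y : tensor) :
  (forall (X : lmodType K) (F : U -> W -> X), bilin F -> tlift F x = tlift F y) -> x = y.
Proof. by move=> h; rewrite -[x]reprK -[y]reprK; apply: tens_eqP. Qed.

Definition tens_add (x y : tensor) : tensor := \pi_tensor (repr x ++ repr y).
Definition tens_zero : tensor := \pi_tensor [::].
Definition tens_scale (a : K) (x : tensor) : tensor :=
  \pi_tensor [seq (a *: p.1, p.2) | p <- repr x].
Definition tens_opp (x : tensor) : tensor := tens_scale (-1) x.

Lemma tlift_add X F x y : bilin F -> @tlift X F (tens_add x y) = tlift F x + tlift F y.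
Proof. by move=> bF; rewrite tliftE // /fsum_eval big_cat. Qed.
Lemma tlift_zero X F : bilin F -> @tlift X F tens_zero = 0.
Proof. by move=> bF; rewrite tliftE // /fsum_eval big_nil. Qed.
Lemma bilinZl (X : lmodType K) (F : U -> W -> X) a u w : bilin F -> F (a *: u) w = a *: F u w.
Proof.
move=> [h _]; have := h w a u 0; rewrite /= addr0.
have := h w (-1) 0 0; rewrite /= scaler0 addr0 scaleN1r addNr => -> ->.
by rewrite addr0.
Qed.
Lemma tlift_scale X F a x : bilin F -> @tlift X F (tens_scale a x) = a *: tlift F x.
Proof.
move=> bF; rewrite tliftE // /fsum_eval big_map scaler_sumr.
by apply: eq_bigr => p _; rewrite /= bilinZl.
Qed.

Lemma tens_addA : associative tens_add.
Proof. by move=> x y z; apply: tens_ext => X F bF; rewrite !tlift_add // addrA. Qed.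
Lemma tens_addC : commutative tens_add.
Proof. by move=> x y; apply: tens_ext => X F bF; rewrite !tlift_add // addrC. Qed.
Lemma tens_add0 : left_id tens_zero tens_add.
Proof. by move=> x; apply: tens_ext => X F bF; rewrite tlift_add // tlift_zero // add0r. Qed.
Lemma tens_addN : left_inverse tens_zero tens_opp tens_add.
Proof.
move=> x; apply: tens_ext => X F bF.
by rewrite tlift_add // tlift_scale // tlift_zero // scaleN1r addNr.
Qed.
HB.instance Definition _ := GRing.isZmodule.Build tensor tens_addA tens_addC tens_add0 tens_addN.

Lemma tens_scaleA a b x : tens_scale a (tens_scale b x) = tens_scale (a * b) x.
Proof. by apply: tens_ext => X F bF; rewrite !tlift_scale // scalerA. Qed.
Lemma tens_scale1 : left_id 1 tens_scale.
Proof. by move=> x; apply: tens_ext => X F bF; rewrite !tlift_scale // scale1r. Qed.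
Lemma tens_scaleDr : right_distributive tens_scale +%R.
Proof.
by move=> a x y; apply: tens_ext => X F bF; rewrite !(tlift_add, tlift_scale) // scalerDr.
Qed.
Lemma tens_scaleDl x : {morph tens_scale^~ x : a b / a + b}.
Proof.
by move=> a b; apply: tens_ext => X F bF; rewrite !(tlift_add, tlift_scale) // scalerDl.
Qed.
HB.instance Definition _ := GRing.Zmodule_isLmodule.Build K tensor
  tens_scaleA tens_scale1 tens_scaleDr tens_scaleDl.

Definition tens (u : U) (w : W) : tensor := \pi_tensor [:: (u, w)].

Lemma tlift_is_linear X F : bilin F -> linear (@tlift X F).
Proof. by move=> bF a x y; rewrite tlift_add // tlift_scale. Qed.
Lemma tlift_tens X F u w : bilin F -> @tlift X F (tens u w) = F u w.
Proof. by move=> bF; rewrite tliftE // /fsum_eval big_seq1. Qed.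
Lemma tens_bilin : bilin tens.
Proof.
split=> [w a u u'|u a w w'] /=; apply: tens_ext => X F bF;
  rewrite tlift_is_linear // !tlift_tens //; [exact: bF.1|exact: bF.2].
Qed.
Lemma tens_sum (x : tensor) : exists l : seq (U * W), x = \sum_(p <- l) tens p.1 p.2.
Proof.
exists (repr x); apply: tens_ext => X F bF; rewrite {1}/tlift /fsum_eval.
elim: (repr x) => [|p l IH]; rewrite ?big_nil ?big_cons.
  by rewrite [RHS]tlift_zero.
by rewrite tlift_add // tlift_tens // IH.
Qed.
End Tensor.

Section TensorMaps.
Variable K : numFieldType.
Implicit Types U W X Z : lmodType K.

Definition tmap U W X Z (f : U -> X) (g : W -> Z) : tensor U W -> tensor X Z :=
  tlift (fun u w => tens (f u) (g w)).

Definition tswap U W : tensor U W -> tensor W U := tlift (fun u w => tens w u).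

Definition tassoc U W X : tensor U (tensor W X) -> tensor (tensor U W) X :=
  tlift (fun u => tlift (fun w x => tens (tens u w) x)).

(* f (x) Id and Id (x) f, followed by the identifications K (x) W = W, U (x) K = U. *)
Definition contrl U W (f : U -> K) : tensor U W -> W := tlift (fun u w => f u *: w).
Definition contrr U W (f : W -> K) : tensor U W -> U := tlift (fun u w => f w *: u).

Definition tpair U W (f : U -> K) (g : W -> K) : tensor U W -> K :=
  tlift (fun u w => f u * g w : K^o).
End TensorMaps.

Section FormalSeries.
Variable K : numFieldType.

Definition binz (n : int) (i : nat) : K :=
  (\prod_(j < i) (n%:~R - j%:R)) / (i`!)%:R.

(* Coefficient of x^a y^b in (x + e y)^n, expanded in nonnegative powers of y. *)
Definition zpow (e : K) (n a b : int) : K :=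
  match b with
  | Posz i => if a == n - i%:Z then e ^+ i * binz n i else 0
  | Negz _ => 0
  end.

(* z0^-1 delta((z1 - z2)/z0) = sum_n z0^(-n-1) (z1 - z2)^n, so the exponent m0 of z0
   determines n = - m0 - 1. The three series below are read off in the same way:
   z0^-1 delta((z2 - z1)/(- z0)), z1^-1 delta((z2 + z0)/z1), z2^-1 delta((z1 - z0)/z2). *)
Definition delta_z1_z2_z0 (m : int * int * int) : K :=
  let '(m0, m1, m2) := m in zpow (-1) (- m0 - 1) m1 m2.

Definition delta_z2_z1_z0 (m : int * int * int) : K :=
  let '(m0, m1, m2) := m in (-1) ^ (- m0 - 1) * zpow (-1) (- m0 - 1) m2 m1.

Definition delta_z2_z0_z1 (m : int * int * int) : K :=
  let '(m0, m1, m2) := m in zpow 1 (- m1 - 1) m2 m0.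

Definition delta_z1_z0_z2 (m : int * int * int) : K :=
  let '(m0, m1, m2) := m in zpow (-1) (- m2 - 1) m1 m0.

(* Product of a scalar series and a vector series. fsbigop returns 0 on an infinite
   support; in the Jacobi identities below every support is finite, because of the
   truncation axioms (supp_z1_z2_z0, supp_z2_z1_z0 and supp_z2_z0_z1). *)
Definition series_mul (X : lmodType K) (S : int * int * int -> K)
    (F : int * int * int -> X) (n : int * int * int) : X :=
  \sum_(m \in [set: int * int * int]) S m *: F (n - m).
End FormalSeries.

(* A direct sum decomposition V = (+)_s V_s over int, given by its projections
   gproj s : V -> V_s. *)
Record graded (K : numFieldType) := Graded {
  gsort :> lmodType K;
  gproj : int -> {linear gsort -> gsort};
  gprojE : forall s t v, gproj s (gproj t v) = if s == t then gproj t v else 0;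
  gproj_sum : forall v, exists2 r : seq int, uniq r & v = \sum_(s <- r) gproj s v;
  gfindim : forall s, exists e : seq gsort, forall v, gproj s v = v ->
    exists a : nat -> K, v = \sum_(i < size e) a i *: e`_i;
  gbounded : exists N : int, forall s v, s < N -> gproj s v = v -> v = 0
}.

Definition homog (K : numFieldType) (V : graded K) (s : int) : set V :=
  [set v | gproj V s v = v].

(* (V (x) V)_n = (+)_(s + t = n) V_s (x) V_t *)
Definition homog2 (K : numFieldType) (V : graded K) (n : int) : set (tensor V V) :=
  [set x | exists l : seq (V * V),
     (forall p, p \in l -> exists2 s, homog s p.1 & homog (n - s) p.2) /\
     x = \sum_(p <- l) tens p.1 p.2].

Definition virasoro (K : numFieldType) (V : lmodType K) (L : int -> V -> V) : Prop :=
  exists d : K, forall (k j : int) (v : V),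
    L k (L j v) - L j (L k v) =
      (k - j)%:~R *: L (k + j) v
      + (if k + j == 0 then (k ^+ 3 - k)%:~R / 12%:R * d else 0) *: v.

Section VOC.
Variables (K : numFieldType) (V : graded K).
Variable D : int -> V -> tensor V V.

(* Ups(z) v = sum_k D_k(v) z^(-k-1): the coefficient of z^n is D_(-n-1)(v). *)
Definition ups (n : int) (v : V) : tensor V V := D (- n - 1) v.

(* (Id (x) Ups(z2)) Ups(z1) v *)
Definition ups_id_ups (v : V) : int * int * int -> tensor (tensor V V) V :=
  fun '(n0, n1, n2) =>
    if n0 == 0 then tassoc (tmap id (ups n2) (ups n1 v)) else 0.
(* (tau (x) Id) (Id (x) Ups(z1)) Ups(z2) v *)
Definition ups_swap_ups (v : V) : int * int * int -> tensor (tensor V V) V :=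
  fun '(n0, n1, n2) =>
    if n0 == 0 then tmap (@tswap _ V V) id (tassoc (tmap id (ups n1) (ups n2 v))) else 0.
(* (Ups(z0) (x) Id) Ups(z2) v *)
Definition ups_ups_id (v : V) : int * int * int -> tensor (tensor V V) V :=
  fun '(n0, n1, n2) =>
    if n1 == 0 then tmap (ups n0) id (ups n2 v) else 0.

Definition voc_jacobi : Prop := forall v n,
  series_mul (@delta_z1_z2_z0 K) (ups_id_ups v) n
  - series_mul (@delta_z2_z1_z0 K) (ups_swap_ups v) n
  = series_mul (@delta_z2_z0_z1 K) (ups_ups_id v) n.
End VOC.

Record voc (K : numFieldType) := Voc {
  voc_space :> graded K;
  voc_D : int -> {linear voc_space -> tensor voc_space voc_space};
  voc_c : {scalar voc_space};
  voc_rho : {scalar voc_space};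
  (* (rho (x) Id) Ups(z) = sum_k L(k) z^(k-2) *)
  voc_L := fun (k : int) (v : voc_space) => contrl voc_rho (ups voc_D (k - 2) v);
  voc_truncated : forall v, exists N : int, forall k, k < N -> voc_D k v = 0;
  voc_degree : forall s k v, homog s v -> homog2 (s + k + 1) (voc_D k v);
  voc_counitl : forall v n,
    contrl voc_c (ups voc_D n v) = if n == 0 then v else 0;
  voc_counitr : forall v n, n <= 0 ->
    contrr voc_c (ups voc_D n v) = if n == 0 then v else 0;
  voc_jacobiP : voc_jacobi voc_D;
  voc_virasoro : virasoro voc_L;
  voc_eigen : forall s v, homog s v <-> voc_L 0 v = s%:~R *: v;
  voc_deriv : forall n v,
    tmap (voc_L 1) id (ups voc_D n v) = (n + 1)%:~R *: ups voc_D (n + 1) v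
}.


Section VOA.
Variables (K : numFieldType) (V : graded K) (Y : V -> int -> V -> V).

(* Y(u,z1) Y(v,z2) w,  Y(v,z2) Y(u,z1) w  and  Y(Y(u,z0) v, z2) w *)
Definition Y_Y_uv (u v w : V) : int * int * int -> V :=
  fun '(n0, n1, n2) => if n0 == 0 then Y u n1 (Y v n2 w) else 0.
Definition Y_Y_vu (u v w : V) : int * int * int -> V :=
  fun '(n0, n1, n2) => if n0 == 0 then Y v n2 (Y u n1 w) else 0.
Definition Y_Y_iter (u v w : V) : int * int * int -> V :=
  fun '(n0, n1, n2) => if n1 == 0 then Y (Y u n0 v) n2 w else 0.

Definition voa_jacobi : Prop := forall u v w n,
  series_mul (@delta_z1_z2_z0 K) (Y_Y_uv u v w) n
  - series_mul (@delta_z2_z1_z0 K) (Y_Y_vu u v w) n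
  = series_mul (@delta_z1_z0_z2 K) (Y_Y_iter u v w) n.
End VOA.

Record voa (K : numFieldType) := Voa {
  voa_space :> graded K;
  voa_mode : int -> voa_space -> voa_space -> voa_space;
  voa_vac : voa_space;
  voa_omega : voa_space;
  (* Y(u,z) v = sum_k u_k v z^(-k-1), with u_k v = voa_mode k u v *)
  voa_Y := fun (u : voa_space) (n : int) => voa_mode (- n - 1) u;
  (* Y(omega,z) = sum_k L(k) z^(-k-2) *)
  voa_L := fun (k : int) => voa_Y voa_omega (- k - 2);
  voa_bilin : forall n, bilin (voa_mode n);
  voa_truncated : forall u v, exists N : int, forall k, N < k -> voa_mode k u v = 0;
  voa_vacl : forall v n, voa_Y voa_vac n v = if n == 0 then v else 0;
  voa_vacr : forall v n, n <= 0 -> voa_Y v n voa_vac = if n == 0 then v else 0;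
  voa_jacobiP : voa_jacobi voa_Y;
  voa_vac0 : homog 0 voa_vac;
  voa_omega2 : homog 2 voa_omega;
  voa_virasoro : virasoro voa_L;
  voa_eigen : forall s v, homog s v <-> voa_L 0 v = s%:~R *: v;
  voa_deriv : forall u n v,
    voa_Y (voa_L (-1) u) n v = (n + 1)%:~R *: voa_Y u (n + 1) v
}.

Section TensorMapsTheory.
Variable K : numFieldType.
Implicit Types U W X Z : lmodType K.

Lemma linear_eq0 U (X : lmodType K) (f : U -> X) : linear f -> f 0 = 0.
Proof. by move=> lf; have := lf (-1) 0 0; rewrite scaler0 addr0 scaleN1r addNr. Qed.
Lemma linear_sumE U (X : lmodType K) (f : U -> X) I (r : seq I) (F : I -> U) :
  linear f -> f (\sum_(i <- r) F i) = \sum_(i <- r) f (F i).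
Proof.
move=> lf; elim: r => [|i r IH]; first by rewrite !big_nil linear_eq0.
by rewrite !big_cons -IH -[F i]scale1r lf !scale1r.
Qed.

Lemma tens_linear_eq U W X (f g : tensor U W -> X) : linear f -> linear g ->
  (forall u w, f (tens u w) = g (tens u w)) -> f =1 g.
Proof.
move=> lf lg fg x; have [l ->] := tens_sum x.
by rewrite !linear_sumE //; apply: eq_bigr.
Qed.

Lemma tmap_bilin U W X Z (f : U -> X) (g : W -> Z) : linear f -> linear g ->
  bilin (fun u w => tens (f u) (g w)).
Proof.
move=> lf lg; have [h1 h2] := @tens_bilin K X Z.
by split=> [w a u u'|u a w w']; rewrite /= (lf, lg) ?h1 ?h2.
Qed.
Lemma tmap_linear U W X Z (f : U -> X) (g : W -> Z) : linear f -> linear g -> linear (tmap f g).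
Proof. by move=> lf lg; apply/tlift_is_linear/tmap_bilin. Qed.
Lemma tmapE U W X Z (f : U -> X) (g : W -> Z) u w : linear f -> linear g ->
  tmap f g (tens u w) = tens (f u) (g w).
Proof. by move=> lf lg; rewrite /tmap tlift_tens //; apply: tmap_bilin. Qed.

Lemma tswap_bilin U W : bilin (fun (u : U) (w : W) => tens w u).
Proof. by have [h1 h2] := @tens_bilin K W U; split=> [w a u u'|u a w w'] /=; rewrite (h1, h2). Qed.
Lemma tswap_linear U W : linear (@tswap K U W).
Proof. exact/tlift_is_linear/tswap_bilin. Qed.
Lemma tswapE U W (u : U) (w : W) : tswap (tens u w) = tens w u.
Proof. by rewrite /tswap tlift_tens //; apply: tswap_bilin. Qed.

Lemma tassoc_bilin1 U W X (u : U) : bilin (fun (w : W) (x : X) => tens (tens u w) x).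
Proof.
have [h1 h2] := @tens_bilin K (tensor U W) X; have [g1 g2] := @tens_bilin K U W.
by split=> [w a u1 u'|u1 a w w'] /=; rewrite ?g2 (h1, h2).
Qed.
Lemma tassoc_bilin U W X :
  bilin (fun u : U => tlift (fun (w : W) (x : X) => tens (tens u w) x)).
Proof.
split=> [y a u u'|u] /=; last exact/tlift_is_linear/tassoc_bilin1.
have [h1 h2] := @tens_bilin K (tensor U W) X; have [g1 g2] := @tens_bilin K U W.
have lin (u0 : U) := tlift_is_linear (@tassoc_bilin1 U W X u0).
have [l ->] := tens_sum y.
rewrite (linear_sumE _ _ (lin _)) (linear_sumE _ _ (lin u)) (linear_sumE _ _ (lin u')).
rewrite scaler_sumr -big_split /=.
apply: eq_bigr => p _; rewrite !tlift_tens ?g1 ?h1 //; exact: tassoc_bilin1.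
Qed.
Lemma tassoc_linear U W X : linear (@tassoc K U W X).
Proof. exact/tlift_is_linear/tassoc_bilin. Qed.
Lemma tassocE U W X (u : U) (w : W) (x : X) :
  tassoc (tens u (tens w x)) = tens (tens u w) x.
Proof.
rewrite /tassoc tlift_tens ?tlift_tens //; [exact: tassoc_bilin1|exact: tassoc_bilin].
Qed.

Lemma contrl_bilin U W (f : U -> K^o) : linear f -> bilin (fun (u : U) (w : W) => f u *: w).
Proof.
move=> lf; split=> [w a u u'|u a w w'] /=; first by rewrite lf scalerDl scalerA.
by rewrite scalerDr !scalerA mulrC.
Qed.
Lemma contrl_linear U W (f : U -> K^o) : linear f -> linear (@contrl K U W f).
Proof. by move=> lf; apply/tlift_is_linear/contrl_bilin. Qed.
Lemma contrlE U W (f : U -> K^o) u w : linear f -> @contrl K U W f (tens u w) = f u *: w.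
Proof. by move=> lf; rewrite /contrl tlift_tens //; apply: contrl_bilin. Qed.

Lemma contrr_bilin U W (f : W -> K^o) : linear f -> bilin (fun (u : U) (w : W) => f w *: u).
Proof.
move=> lf; split=> [w a u u'|u a w w'] /=; last by rewrite lf scalerDl scalerA.
by rewrite scalerDr !scalerA mulrC.
Qed.
Lemma contrr_linear U W (f : W -> K^o) : linear f -> linear (@contrr K U W f).
Proof. by move=> lf; apply/tlift_is_linear/contrr_bilin. Qed.
Lemma contrrE U W (f : W -> K^o) u w : linear f -> @contrr K U W f (tens u w) = f w *: u.
Proof. by move=> lf; rewrite /contrr tlift_tens //; apply: contrr_bilin. Qed.

Lemma tpair_bilin U W (f : U -> K^o) (g : W -> K^o) : linear f -> linear g ->
  bilin (fun (u : U) (w : W) => f u * g w : K^o).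
Proof.
move=> lf lg; split=> [w a u u'|u a w w'] /=; first by rewrite lf mulrDl scalerAl.
by rewrite lg mulrDr scalerAr.
Qed.
Lemma tpair_linear U W (f : U -> K^o) (g : W -> K^o) : linear f -> linear g ->
  linear (tpair f g : tensor U W -> K^o).
Proof. by move=> lf lg; apply/tlift_is_linear/tpair_bilin. Qed.
Lemma tpairE U W (f : U -> K^o) (g : W -> K^o) u w : linear f -> linear g ->
  tpair f g (tens u w) = f u * g w.
Proof. by move=> lf lg; rewrite /tpair tlift_tens //; apply: tpair_bilin. Qed.

Lemma linear_id U : linear (id : U -> U). Proof. by []. Qed.
Lemma linear_comp U W X (f : U -> W) (g : W -> X) : linear f -> linear g -> linear (g \o f).
Proof. by move=> lf lg a u v; rewrite /= lf lg. Qed.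

Lemma tpair_tmap U W X Z (f : U -> X) (g : W -> Z) (h : X -> K^o) (k : Z -> K^o) x :
  linear f -> linear g -> linear h -> linear k ->
  tpair h k (tmap f g x) = tpair (h \o f) (k \o g) x.
Proof.
move=> lf lg lh lk; have lhf := linear_comp lf lh; have lkg := linear_comp lg lk.
apply: (@tens_linear_eq _ _ K^o (tpair h k \o tmap f g)).
- exact: linear_comp (tmap_linear lf lg) (tpair_linear lh lk).
- exact: tpair_linear.
- by move=> u w; rewrite /= tmapE // !tpairE.
Qed.
Lemma tpair_swap U W (h : W -> K^o) (k : U -> K^o) (x : tensor U W) :
  linear h -> linear k -> tpair h k (tswap x) = tpair k h x.
Proof.
move=> lh lk; apply: (@tens_linear_eq _ _ K^o (tpair h k \o @tswap K U W)).
- exact: linear_comp (@tswap_linear U W) (tpair_linear lh lk).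
- exact: tpair_linear.
- by move=> u w; rewrite /= tswapE !tpairE // mulrC.
Qed.
Lemma tpair_assoc U W X (h : U -> K^o) (k : W -> K^o) (m : X -> K^o) x :
  linear h -> linear k -> linear m ->
  tpair (tpair h k) m (tassoc x) = tpair h (tpair k m) x.
Proof.
move=> lh lk lm; have lhk := tpair_linear lh lk; have lkm := tpair_linear lk lm.
have l1 := linear_comp (@tassoc_linear U W X) (tpair_linear lhk lm).
have l2 := tpair_linear lh lkm.
apply: (@tens_linear_eq _ _ K^o (tpair (tpair h k) m \o @tassoc K U W X)) => // u y.
have [_ t2] := @tens_bilin K U (tensor W X).
apply: (@tens_linear_eq _ _ K^o (tpair (tpair h k) m \o @tassoc K U W X \o tens u) (tpair h (tpair k m) \o tens u)).
- exact: linear_comp (t2 u) l1.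
- exact: linear_comp (t2 u) l2.
- by move=> w v; rewrite /= tassocE !tpairE // mulrA.
Qed.
Lemma tpair_contrl U W (h : U -> K^o) (k : W -> K^o) x : linear h -> linear k ->
  k (contrl h x) = tpair h k x.
Proof.
move=> lh lk; apply: (@tens_linear_eq _ _ K^o (k \o contrl h)).
- exact: linear_comp (contrl_linear lh) lk.
- exact: tpair_linear.
- by move=> u w; rewrite /= contrlE // tpairE // -[_ *: w]addr0 lk linear_eq0 // addr0.
Qed.
Lemma tpair_contrr U W (h : U -> K^o) (k : W -> K^o) x : linear h -> linear k ->
  h (contrr k x) = tpair h k x.
Proof.
move=> lh lk; apply: (@tens_linear_eq _ _ K^o (h \o contrr k)).
- exact: linear_comp (contrr_linear lk) lh.
- exact: tpair_linear.
- by move=> u w; rewrite /= contrrE // tpairE // -[_ *: u]addr0 lh linear_eq0 // addr0 mulrC.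
Qed.
End TensorMapsTheory.


Section GradedTheory.
Variables (K : numFieldType) (V : graded K).

Lemma gproj_homog s (v : V) : homog s (gproj V s v).
Proof. by rewrite /homog /= gprojE eqxx. Qed.
Lemma gproj_eq s t (v : V) : homog s v -> gproj V t v = if t == s then v else 0.
Proof. by move=> hv; rewrite -[v in LHS]hv gprojE; case: eqP => // _; rewrite hv. Qed.
Lemma homog0 s : homog s (0 : V). Proof. exact: linear0. Qed.

Lemma gproj_linear s : linear (gproj V s). Proof. exact: linearP. Qed.

Lemma gproj_contrl n s (f : V -> K^o) x : linear f -> homog2 n x ->
  gproj V s (contrl f x) = contrl (f \o gproj V (n - s)) x.
Proof.
move=> lf [l [hl ->]]; have lfg := linear_comp (@gproj_linear (n - s)) lf.
rewrite (linear_sumE _ _ (contrl_linear lf)) (linear_sumE _ _ (contrl_linear lfg)).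
rewrite linear_sum; apply: eq_big_seq => p /hl [a ha hb] /=.
rewrite !contrlE // linearZ /= (gproj_eq _ ha) (gproj_eq _ hb).
have -> : (s == n - a) = (n - s == a) by rewrite eq_sym subr_eq [RHS]subr_eq addrC.
have f0 : f 0 = 0 :> K := linear_eq0 lf.
by case: eqP => // _; rewrite f0 scale0r scaler0.
Qed.
Lemma gproj_contrr n s (f : V -> K^o) x : linear f -> homog2 n x ->
  gproj V s (contrr f x) = contrr (f \o gproj V (n - s)) x.
Proof.
move=> lf [l [hl ->]]; have lfg := linear_comp (@gproj_linear (n - s)) lf.
rewrite (linear_sumE _ _ (contrr_linear lf)) (linear_sumE _ _ (contrr_linear lfg)).
rewrite linear_sum; apply: eq_big_seq => p /hl [a ha hb] /=.
rewrite !contrrE // linearZ /= (gproj_eq _ ha) (gproj_eq _ hb).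
have -> : (n - s == n - a) = (s == a) by rewrite (inj_eq (addrI _)) eqr_opp.
have f0 : f 0 = 0 :> K := linear_eq0 lf.
by case: eqP => // _; rewrite f0 scale0r scaler0.
Qed.

Lemma tpair_deg a b n (f g : V -> K^o) x : linear f -> linear g ->
  (forall s v, s != a -> homog s v -> f v = 0) ->
  (forall s v, s != b -> homog s v -> g v = 0) ->
  homog2 n x -> n != a + b -> tpair f g x = 0.
Proof.
move=> lf lg hf hg [l [hl ->]] nab; rewrite (linear_sumE _ _ (tpair_linear lf lg)).
rewrite big1_seq // => p /andP[_ /hl [s hs hns]]; rewrite tpairE //.
have [es|ns] := eqVneq s a; last by rewrite (hf s) // mul0r.
rewrite (hg (n - s)) ?mulr0 //; apply: contraNneq nab => <-.
by rewrite es addrC subrK.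
Qed.

Lemma homog_ext (f g : V -> K^o) : linear f -> linear g ->
  (forall s v, homog s v -> f v = g v) -> f =1 g.
Proof.
move=> lf lg fg v; have [r _ ->] := gproj_sum v.
rewrite !linear_sumE //; apply: eq_bigr => s _; apply: (fg s); exact: gproj_homog.
Qed.
End GradedTheory.

Section VOCTheory.
Variables (K : numFieldType) (V : voc K).
Notation c := (voc_c V : V -> K^o).
Notation rho := (voc_rho V : V -> K^o).
Notation D := (@voc_D K V).
Notation L := (@voc_L K V).

Lemma voc_c_linear : linear c. Proof. exact: (@linearP _ _ _ _ (voc_c V)). Qed.
Lemma voc_rho_linear : linear rho. Proof. exact: (@linearP _ _ _ _ (voc_rho V)). Qed.
Lemma voc_D_linear k : linear (D k). Proof. exact: linearP. Qed.
Lemma ups_linear n : linear (ups D n). Proof. exact: voc_D_linear. Qed.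
Lemma voc_L_linear k : linear (L k).
Proof. exact: linear_comp (ups_linear _) (contrl_linear voc_rho_linear). Qed.

(* The counit axioms force c to vanish off V_0, and then the Virasoro axioms force rho
   to vanish off V_2 (voc_rho_proj); so V' is a vertex operator algebra even when c or
   rho is zero. *)
Lemma voc_c_proj v : c (gproj V 0 v) = c v.
Proof.
have lc := voc_c_linear; have lc0 s := linear_comp (gproj_linear s) lc.
apply: (homog_ext (lc0 0) lc) => t w hw /=.
have hx : homog2 t (ups D 0 w) by have := voc_degree (-1) hw; rewrite addrNK /ups oppr0 sub0r.
have el : contrl c (ups D 0 w) = w by rewrite voc_counitl.
have er : contrr c (ups D 0 w) = w by rewrite voc_counitr.
have er0 : contrr (c \o gproj V 0) (ups D 0 w) = w.
  by rewrite -[in RHS]hw -[in RHS]er (gproj_contrr _ lc hx) subrr.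
by rewrite -[in RHS]er0 (tpair_contrr _ lc (lc0 0)) -(tpair_contrl _ lc (lc0 0)) el.
Qed.

Lemma voc_L_deg k s v : homog s v -> homog (s - k) (L k v).
Proof.
move=> hv; apply/voc_eigen; have [d vir] := voc_virasoro V.
have {vir} := vir 0 k v.
have -> : (0 ^+ 3 - 0 : int) = 0 by [].
rewrite mulr0z !mul0r if_same scale0r addr0 !add0r.
have /voc_eigen -> := hv; have -> : L k (s%:~R *: v) = s%:~R *: L k v.
  by have := voc_L_linear k s%:~R v 0; rewrite addr0 (linear_eq0 (voc_L_linear k)) addr0.
by move=> /eqP; rewrite subr_eq => /eqP ->; rewrite -scalerDl -rmorphD addrC.
Qed.

Lemma voc_rhoE v : rho v = c (L 2 v).
Proof.
have lc := voc_c_linear; have lr := voc_rho_linear.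
by rewrite /voc_L subrr tpair_contrl // -tpair_contrr // voc_counitr.
Qed.

Lemma voc_rho_proj v : rho (gproj V 2 v) = rho v.
Proof.
have lr := voc_rho_linear; apply: (homog_ext (linear_comp (gproj_linear 2) lr) lr) => s w hw /=.
rewrite (gproj_eq _ hw); case: eqP => // /eqP ns; rewrite (linear_eq0 lr).
rewrite voc_rhoE -voc_c_proj (gproj_eq _ (voc_L_deg 2 hw)).
by rewrite eq_sym subr_eq0 eq_sym (negbTE ns) (linear_eq0 voc_c_linear).
Qed.
End VOCTheory.


Section Dual.
Variables (K : numFieldType) (V : graded K).

(* V' = (+)_s V_s^* is realized as the linear functionals on V that vanish on all
   but finitely many V_s; V_s^* becomes the functionals that factor through gproj s. *)
Definition rdual_pred : {pred V -> K^o} := fun f =>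
  `[< linear f /\ exists r : seq int, forall s v, s \notin r -> homog s v -> f v = 0 >].

Lemma rdual_pred_submod : submod_closed rdual_pred.
Proof.
split.
  apply/asboolP; split; last by exists [::].
  by move=> a u v; rewrite scaler0 addr0.
move=> a f g /asboolP[lf [rf hf]] /asboolP[lg [rg hg]]; apply/asboolP; split.
  move=> b u v; rewrite !fctE lf lg !scalerDr addrACA; congr (_ + _ + _).
  by rewrite !scalerA mulrC.
exists (rf ++ rg) => s v; rewrite mem_cat negb_or => /andP[sf sg] hv.
by rewrite !fctE (hf s) // (hg s) // scaler0 addr0.
Qed.
HB.instance Definition _ :=
  GRing.isSubmodClosed.Build K (V -> K^o) rdual_pred rdual_pred_submod.

Record rdual := RDual { rdual_fun :> V -> K^o; rdual_funP : rdual_fun \in rdual_pred }.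
HB.instance Definition _ := [isSub of rdual for rdual_fun].
HB.instance Definition _ := [Choice of rdual by <:].
HB.instance Definition _ := [SubChoice_isSubLmodule of rdual by <:].

Lemma rdual_linear (f : rdual) : linear f.
Proof. by case: f => f /= /asboolP[]. Qed.
Lemma rdual_finite (f : rdual) :
  exists r : seq int, forall s v, s \notin r -> homog s v -> f v = 0.
Proof. by case: f => f /= /asboolP[]. Qed.
Lemma rdual_ext (f g : rdual) : (forall v, f v = g v) -> f = g.
Proof. by move=> fg; apply/val_inj/funext. Qed.
Lemma rdual_homog_ext (f g : rdual) : (forall s v, homog s v -> f v = g v) -> f = g.
Proof. by move=> fg; apply/rdual_ext/homog_ext => //; exact: rdual_linear. Qed.
Lemma rdualD (f g : rdual) v : (f + g) v = f v + g v. Proof. by []. Qed.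
Lemma rdualN (f : rdual) v : (- f) v = - f v. Proof. by []. Qed.
Lemma rdualZ a (f : rdual) v : (a *: f) v = a *: f v. Proof. by []. Qed.
Lemma rdual0 v : (0 : rdual) v = 0. Proof. by []. Qed.
Lemma rdual_ev_linear v : linear (fun f : rdual => f v).
Proof. by move=> a f g; rewrite rdualD rdualZ. Qed.

Lemma rproj_subproof s (f : rdual) : (f \o gproj V s : V -> K^o) \in rdual_pred.
Proof.
apply/asboolP; split; first exact: linear_comp (gproj_linear s) (rdual_linear f).
exists [:: s] => t v; rewrite inE => ts hv /=.
by rewrite (gproj_eq _ hv) eq_sym (negbTE ts) (linear_eq0 (rdual_linear f)).
Qed.
Definition rproj s (f : rdual) : rdual := RDual (rproj_subproof s f).
Lemma rprojv s f v : rproj s f v = f (gproj V s v). Proof. by []. Qed.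
Lemma rproj_linear s : linear (rproj s).
Proof. by move=> a f g; apply: rdual_ext => v; rewrite !(rprojv, rdualD, rdualZ). Qed.
HB.instance Definition _ s :=
  GRing.isLinear.Build K rdual rdual *:%R (rproj s) (rproj_linear s).

Lemma rprojE s t f : rproj s (rproj t f) = if s == t then rproj t f else 0.
Proof.
apply: rdual_ext => v; rewrite !rprojv gprojE eq_sym.
by case: eqP => [->|_] //; rewrite (linear_eq0 (rdual_linear f)).
Qed.

Lemma rproj_sum f : exists2 r : seq int, uniq r & f = \sum_(s <- r) rproj s f.
Proof.
have [r hr] := rdual_finite f; exists (undup r); first exact: undup_uniq.
have lf := rdual_linear f; apply: rdual_homog_ext => t w hw.
rewrite (linear_sumE _ _ (rdual_ev_linear w)).
under eq_bigr do rewrite rprojv (gproj_eq _ hw).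
have [tr|tr] := boolP (t \in r).
  rewrite (bigD1_seq t) ?mem_undup ?undup_uniq //= eqxx big1 ?addr0 // => s /negbTE ->.
  exact: linear_eq0.
rewrite (hr t) // big1_seq // => s /andP[_]; rewrite mem_undup.
by case: eqP => [->|_ _]; [rewrite (negbTE tr)|rewrite linear_eq0].
Qed.

Lemma rdual_span (e : seq V) : forall H : rdual -> Prop,
  (forall a f g, H f -> H g -> H (a *: f + g)) ->
  exists2 F : seq rdual, forall g, g \in F -> H g & forall f, H f -> exists a : nat -> K,
    forall v, v \in e -> (f - \sum_(i < size F) a i *: F`_i) v = 0.
Proof.
have sumv (F : seq rdual) (a : nat -> K) v :
    (\sum_(i < size F) a i *: F`_i) v = \sum_(i < size F) a i * F`_i v.
  by rewrite (linear_sumE _ _ (rdual_ev_linear v)).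
elim: e => [|e0 e IH] H HH; first by exists [::] => // f _; exists (fun=> 0).
have [|F HF hF] := IH (fun f => H f /\ f e0 = 0).
  by move=> a f g [hf f0] [hg g0]; split; [exact: HH|rewrite rdualD rdualZ f0 g0 scaler0 addr0].
have F0 (a : nat -> K) : \sum_(i < size F) a i * F`_i e0 = 0.
  by apply: big1 => i _; have [_ ->] := HF _ (mem_nth 0 (ltn_ord i)); rewrite mulr0.
have [[f0 [hf0 n0]]|no] := pselect (exists f0, H f0 /\ f0 e0 <> 0); last first.
  exists F => [g /HF[]//|f hf].
  have f0 : f e0 = 0 by apply: contrapT => n0; apply: no; exists f.
  have [a ha] := hF f (conj hf f0); exists a => v; rewrite inE => /predU1P[->|/ha //].
  by rewrite rdualD rdualN sumv F0 f0 oppr0 addr0.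
exists (f0 :: F) => [g|f hf]; first by rewrite inE => /predU1P[->//|/HF[]].
pose b : K := f e0 / f0 e0.
have fb0 : ((- b) *: f0 + f) e0 = 0.
  rewrite rdualD rdualZ scaleNr /b -[_ *: _]/(_ * _) divfK ?addNr //; exact/eqP.
have [a ha] := hF _ (conj (HH (- b) f0 f hf0 hf) fb0).
exists (fun i => if i is j.+1 then a j else b) => v.
have -> : f - \sum_(i < size (f0 :: F)) (if (i : nat) is j.+1 then a j else b) *: (f0 :: F)`_i
        = ((- b) *: f0 + f) - \sum_(i < size F) a i *: F`_i.
  by rewrite big_ord_recl /= opprD addrA scaleNr [- _ + f]addrC.
rewrite inE => /predU1P[->|/ha //].
by rewrite rdualD rdualN sumv F0 fb0 oppr0 addr0.
Qed.

Lemma rdual_findim s : exists e : seq rdual, forall f, rproj s f = f ->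
  exists a : nat -> K, f = \sum_(i < size e) a i *: e`_i.
Proof.
have [e he] := @gfindim K V s.
have [|F HF hF] := @rdual_span e (fun f => rproj s f = f).
  by move=> a f g hf hg; rewrite rproj_linear hf hg.
exists F => f hf; have [a ha] := hF f hf; exists a.
apply/eqP; rewrite -subr_eq0; apply/eqP; set g := _ - _ in ha *.
have hg : rproj s g = g.
  rewrite /g linearB /= hf linear_sum /=; congr (_ - _); apply: eq_bigr => i _.
  by rewrite linearZ /= HF // mem_nth.
have lg := rdual_linear g.
apply: rdual_homog_ext => t v hv; rewrite rdual0 -hg rprojv (gproj_eq _ hv).
case: eqP => [st|_]; last exact: linear_eq0.
have [b ->] := he v (etrans (congr1 (fun t => gproj V t v) st) hv).
rewrite linear_sumE // big1 // => i _.
have := lg (b i) e`_i 0; rewrite addr0 => ->.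
by rewrite (linear_eq0 lg) addr0 ha ?scaler0 // mem_nth.
Qed.

Lemma rdual_bounded : exists N : int, forall s f, s < N -> rproj s f = f -> f = 0.
Proof.
have [N hN] := @gbounded K V; exists N => s f sN hf.
apply: rdual_ext => v; rewrite -hf rprojv (hN s _ sN (gproj_homog s v)).
by rewrite (linear_eq0 (rdual_linear f)).
Qed.

Definition dual_graded : graded K :=
  @Graded K rdual (fun s => rproj s : {linear rdual -> rdual})
    rprojE rproj_sum rdual_findim rdual_bounded.
End Dual.

Section DualVOA.
Variables (K : numFieldType) (V : voc K).
Notation V' := (dual_graded V).
Notation c := (voc_c V : V -> K^o).
Notation rho := (voc_rho V : V -> K^o).
Notation D := (@voc_D K V).
Notation L := (@voc_L K V).

Lemma dual_mode_subproof k (f g : rdual V) :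
  (fun v => tpair f g (D k v) : K^o) \in @rdual_pred K V.
Proof.
have lf := rdual_linear f; have lg := rdual_linear g.
apply/asboolP; split; first exact: linear_comp (@voc_D_linear K V k) (tpair_linear lf lg).
have [rf hf] := rdual_finite f; have [rg hg] := rdual_finite g.
exists [seq a + b - k - 1 | a <- rf, b <- rg] => s v sr /(voc_degree k)[l [hl ->]].
rewrite (linear_sumE _ _ (tpair_linear lf lg)) big1_seq // => p /andP[_ /hl [a ha hb]].
rewrite tpairE //; have [ar|ar] := boolP (a \in rf); last by rewrite (hf a) // mul0r.
have [br|br] := boolP (s + k + 1 - a \in rg); last by rewrite (hg _ _ br hb) mulr0.
have /negP[] := sr; apply/allpairsP; exists (a, s + k + 1 - a); split=> //=.
by rewrite [a + _]addrC subrK addrAC !addrK.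
Qed.
(* (f_k g, v) = (f (x) g, D_k v), that is (Y(f,z) g, v) = (f (x) g, Ups(z) v). *)
Definition dual_mode k (f g : rdual V) : rdual V := RDual (dual_mode_subproof k f g).

Lemma dual_vac_subproof : (fun v => c (gproj V 0 v)) \in @rdual_pred K V.
Proof.
apply/asboolP; split; first exact: linear_comp (gproj_linear 0) (@voc_c_linear _ V).
exists [:: 0] => t v; rewrite inE => ts hv.
by rewrite (gproj_eq _ hv) eq_sym (negbTE ts) linear0.
Qed.
Definition dual_vac : rdual V := RDual dual_vac_subproof.

Lemma dual_omega_subproof : (fun v => rho (gproj V 2 v)) \in @rdual_pred K V.
Proof.
apply/asboolP; split; first exact: linear_comp (gproj_linear 2) (@voc_rho_linear _ V).
exists [:: 2] => t v; rewrite inE => ts hv.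
by rewrite (gproj_eq _ hv) eq_sym (negbTE ts) linear0.
Qed.
Definition dual_omega : rdual V := RDual dual_omega_subproof.
End DualVOA.


Section DualVOAAxioms.
Variables (K : numFieldType) (V : voc K).
Notation V' := (dual_graded V).
Notation c := (voc_c V : V -> K^o).
Notation rho := (voc_rho V : V -> K^o).
Notation D := (@voc_D K V).
Notation L := (@voc_L K V).
Notation "1'" := (dual_vac V).
Notation w' := (dual_omega V).
Let Y (u : rdual V) (n : int) : rdual V -> rdual V := dual_mode (- n - 1) u.
Let L' (k : int) : rdual V -> rdual V := Y w' (- k - 2).

Lemma dual_YE u n v x : Y u n v x = tpair u v (ups D n x).
Proof. by []. Qed.

Lemma dual_vacE : 1' = voc_c V :> (V -> K).
Proof. by apply/funext => v; apply: voc_c_proj. Qed.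
Lemma dual_omegaE : w' = voc_rho V :> (V -> K).
Proof. by apply/funext => v; apply: voc_rho_proj. Qed.

Lemma dual_LE k f x : L' k f x = f (L (- k) x).
Proof.
rewrite /L' dual_YE dual_omegaE tpair_contrl //; [exact: voc_rho_linear|exact: rdual_linear].
Qed.

Lemma dual_bilin n : bilin (@dual_mode K V n).
Proof.
split=> [w a u u'|u a w w']; apply: rdual_ext => x;
  rewrite rdualD rdualZ /dual_mode /=.
  have lw := rdual_linear w; have lu := rdual_linear u; have lu' := rdual_linear u'.
  have luu := rdual_linear (a *: u + u').
  have l1 := tpair_linear lu lw; have l2 := tpair_linear lu' lw.
  have [l ->] := tens_sum (D n x).
  rewrite (linear_sumE _ _ l1) (linear_sumE _ _ l2).
  rewrite (linear_sumE _ _ (tpair_linear luu lw)).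
  rewrite scaler_sumr -big_split; apply: eq_bigr => p _ /=.
  rewrite !tpairE //.
  transitivity ((a * u p.1 + u' p.1) * w p.2); first by [].
  by rewrite mulrDl -mulrA.
have lw := rdual_linear w; have lu := rdual_linear u; have lw' := rdual_linear w'.
have lww := rdual_linear (a *: w + w').
have l1 := tpair_linear lu lw; have l2 := tpair_linear lu lw'.
have [l ->] := tens_sum (D n x).
rewrite (linear_sumE _ _ l1) (linear_sumE _ _ l2).
rewrite (linear_sumE _ _ (tpair_linear lu lww)).
rewrite scaler_sumr -big_split; apply: eq_bigr => p _ /=.
rewrite !tpairE //.
transitivity (u p.1 * (a * w p.2 + w' p.2)); first by [].
by rewrite mulrDr mulrCA.
Qed.

Lemma seq_int_ub (r : seq int) : exists M : int, forall a, a \in r -> a <= M.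
Proof.
elim: r => [|b r [M hM]]; first by exists 0.
exists (Num.max b M) => a; rewrite inE le_max => /predU1P[->|/hM ->]; by rewrite ?lexx ?orbT.
Qed.

Lemma dual_truncated (u v : rdual V) :
  exists N : int, forall k, N < k -> dual_mode k u v = 0.
Proof.
have lu := rdual_linear u; have lv := rdual_linear v.
have [ru hu] := rdual_finite u; have [rv hv] := rdual_finite v.
have [Mu hMu] := seq_int_ub ru; have [Mv hMv] := seq_int_ub rv.
have [N hN] := @gbounded K V; exists (Mu + Mv - 1 - N) => k hk.
apply: rdual_homog_ext => s x hx; rewrite rdual0 /=.
have [sN|sN] := ltP s N.
  rewrite (hN s x) // (linear_eq0 (@voc_D_linear K V k)).
  exact: (linear_eq0 (tpair_linear lu lv)).
have [l [hl ->]] := voc_degree k hx.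
rewrite (linear_sumE _ _ (tpair_linear lu lv)) big1_seq // => p /andP[_ /hl [a ha hb]].
rewrite tpairE //; have [ar|ar] := boolP (a \in ru); last by rewrite (hu a) // mul0r.
have [br|br] := boolP (s + k + 1 - a \in rv); last by rewrite (hv _ _ br hb) mulr0.
have := hMu _ ar; have := hMv _ br; lia.
Qed.

Lemma dual_vacl v n : Y 1' n v = if n == 0 then v else 0.
Proof.
apply: rdual_ext => x; have lv := rdual_linear v.
rewrite dual_YE dual_vacE -tpair_contrl //; last exact: voc_c_linear.
by rewrite voc_counitl; case: eqP => // _; rewrite (linear_eq0 lv).
Qed.
Lemma dual_vacr v n : n <= 0 -> Y v n 1' = if n == 0 then v else 0.
Proof.
move=> n0; apply: rdual_ext => x; have lv := rdual_linear v.
rewrite dual_YE dual_vacE -tpair_contrr //; last exact: voc_c_linear.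
by rewrite voc_counitr //; case: eqP => // _; rewrite (linear_eq0 lv).
Qed.

Lemma dual_vac0 : @homog K V' 0 1'.
Proof. by apply: rdual_ext => v; rewrite /= gprojE eqxx. Qed.
Lemma dual_omega2 : @homog K V' 2 w'.
Proof. by apply: rdual_ext => v; rewrite /= gprojE eqxx. Qed.

Lemma dual_virasoro : virasoro (V := V') L'.
Proof.
have [d hd] := voc_virasoro V; exists d => k j f; apply: rdual_ext => x.
have lf := rdual_linear f.
have lfD a b y z : f (a *: y + b *: z) = a * f y + b * f z.
  by rewrite lf; congr (_ + _); have := lf b z 0; rewrite !addr0 (linear_eq0 lf) addr0.
have fB y z : f (y - z) = f y - f z.
  by have := lfD 1 (-1) y z; rewrite !scale1r scaleN1r mul1r mulN1r.
rewrite !(rdualD, rdualN, rdualZ) !dual_LE -fB hd lfD.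
have -> : - j - - k = k - j by lia.
have -> : - j - k = - (k + j) by lia.
rewrite oppr_eq0; case: eqP => // kj; have -> : - j = k by lia.
by [].
Qed.

Lemma dual_eigen s f : @homog K V' s f <-> L' 0 f = s%:~R *: f.
Proof.
have lf := rdual_linear f; have fZ a v : f (a *: v) = a *: f v.
  by have := lf a v 0; rewrite addr0 (linear_eq0 lf) addr0.
split=> [hf|hf].
  apply: rdual_homog_ext => t v hv; rewrite dual_LE rdualZ oppr0.
  have /voc_eigen -> := hv; rewrite fZ.
  have [->//|st] := eqVneq s t; suff -> : f v = 0 by rewrite !scaler0.
  rewrite -[f in LHS]hf -[LHS]/(f (gproj V s v)) (gproj_eq _ hv) (negbTE st).
  exact: linear_eq0.
apply: rdual_homog_ext => t v hv; rewrite rprojv (gproj_eq _ hv).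
case: eqP => // /eqP st; rewrite (linear_eq0 lf).
have /voc_eigen hv' := hv.
have := congr1 (fun g : rdual V => g v) hf.
rewrite dual_LE rdualZ oppr0 hv' fZ => /eqP; rewrite -subr_eq0 -scalerBl scaler_eq0.
by rewrite subr_eq0 eqr_int eq_sym (negbTE st) /= => /eqP.
Qed.

Lemma dual_deriv u n v : Y (L' (-1) u) n v = (n + 1)%:~R *: Y u (n + 1) v.
Proof.
apply: rdual_ext => x; have lu := rdual_linear u; have lv := rdual_linear v.
have l := tpair_linear lu lv; rewrite rdualZ !dual_YE.
have lZ a y : tpair u v (a *: y) = a *: (tpair u v y : K^o).
  by have := l a y 0; rewrite addr0 (linear_eq0 l) addr0.
rewrite -lZ -voc_deriv tpair_tmap //; last exact: voc_L_linear.
by congr tpair; apply/funext => y; rewrite dual_LE opprK.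
Qed.
End DualVOAAxioms.


Section DualJacobi.
Variable K : numFieldType.

Lemma binz_neg (n : int) (i : nat) : binz K (i%:Z - n - 1) i = (-1) ^+ i * binz K n i.
Proof.
rewrite /binz mulrA; congr (_ / _); rewrite (reindex_inj rev_ord_inj) /=.
rewrite -[X in (-1) ^+ X]card_ord -prodrN; apply: eq_bigr => j _.
have hj := ltn_ord j; rewrite !pmulrn -!rmorphB -rmorphN /=; congr (_%:~R); lia.
Qed.

Lemma delta_z2_z0_z1E : delta_z2_z0_z1 K = delta_z1_z0_z2 K.
Proof.
apply/funext => -[[m0 m1] m2] /=; case: m0 => [i|i] //=.
have -> : (m2 == - m1 - 1 - i%:Z) = (m1 == - m2 - 1 - i%:Z) by lia.
case: eqP => // ->; rewrite expr1n mul1r.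
have -> : - (- m2 - 1 - i%:Z) - 1 = i%:Z - (- m2 - 1) - 1 by lia.
by rewrite binz_neg.
Qed.

Definition supp_in (X : lmodType K) (S : int * int * int -> K) (F : int * int * int -> X)
    n (l : seq (int * int * int)) :=
  forall m, m \notin l -> S m *: F (n - m) = 0.

Lemma series_mul_transfer (X1 X2 : lmodType K) (f1 : X1 -> K^o) (f2 : X2 -> K^o) S F1 F2 n :
  linear f1 -> linear f2 ->
  (exists l, supp_in S F1 n l) -> (exists l, supp_in S F2 n l) ->
  (forall m, f1 (F1 m) = f2 (F2 m)) -> f1 (series_mul S F1 n) = f2 (series_mul S F2 n).
Proof.
move=> lf1 lf2 [l1 h1] [l2 h2] f12; rewrite /series_mul.
pose A := seq_fset tt (l1 ++ l2).
have hA m : m \notin A -> (m \notin l1) * (m \notin l2).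
  by rewrite seq_fsetE mem_cat negb_or => /andP[].
rewrite (fsbigTE A) => [|m /hA[+ _]]; last exact: h1.
rewrite (fsbigTE A) => [|m /hA[_]]; last exact: h2.
rewrite (linear_sumE _ _ lf1) (linear_sumE _ _ lf2); apply: eq_bigr => m _.
have := lf1 (S m) (F1 (n - m)) 0; have := lf2 (S m) (F2 (n - m)) 0.
by rewrite !addr0 (linear_eq0 lf1) (linear_eq0 lf2) !addr0 => -> ->; rewrite f12.
Qed.

Variable X : lmodType K.
Implicit Types G : int -> int -> X.

Lemma supp_z1_z2_z0 G n0 n1 n2 :
  (exists B : nat, forall i : nat, (B <= i)%N -> G (n1 + n0 + 1 + i%:Z) (n2 - i%:Z) = 0) ->
  exists l, supp_in (@delta_z1_z2_z0 K)
    (fun '(k0, k1, k2) => if k0 == 0 then G k1 k2 else 0) (n0, n1, n2) l.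
Proof.
case=> B hB; exists [seq (n0, - n0 - 1 - (i : nat)%:Z, i%:Z) | i <- iota 0 B].
case=> -[m0 m1] [i|i] /negP nin /=; last by rewrite scale0r.
rewrite subr_eq0; case: (n0 =P m0) => [e0|]; last by rewrite scaler0.
case: eqP => [e1|]; last by rewrite scale0r.
have [iB|Bi] := ltnP i B.
  by case: nin; apply/mapP; exists i; rewrite ?mem_iota // e1 e0.
have -> : n1 - m1 = n1 + n0 + 1 + i%:Z by rewrite e1 e0; lia.
by rewrite hB // scaler0.
Qed.

Lemma supp_z2_z1_z0 G n0 n1 n2 :
  (exists B : nat, forall i : nat, (B <= i)%N -> G (n1 - i%:Z) (n2 + n0 + 1 + i%:Z) = 0) ->
  exists l, supp_in (@delta_z2_z1_z0 K)
    (fun '(k0, k1, k2) => if k0 == 0 then G k1 k2 else 0) (n0, n1, n2) l.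
Proof.
case=> B hB; exists [seq (n0, (i : nat)%:Z, - n0 - 1 - i%:Z) | i <- iota 0 B].
case=> -[m0 [i|i]] m2 /negP nin /=; last by rewrite mulr0 scale0r.
rewrite subr_eq0; case: (n0 =P m0) => [e0|]; last by rewrite scaler0.
case: eqP => [e1|]; last by rewrite mulr0 scale0r.
have [iB|Bi] := ltnP i B.
  by case: nin; apply/mapP; exists i; rewrite ?mem_iota // e1 e0.
have -> : n2 - m2 = n2 + n0 + 1 + i%:Z by rewrite e1 e0; lia.
by rewrite hB // scaler0.
Qed.

Lemma supp_z2_z0_z1 G n0 n1 n2 :
  (exists B : nat, forall i : nat, (B <= i)%N -> G (n0 - i%:Z) (n2 + n1 + 1 + i%:Z) = 0) ->
  exists l, supp_in (@delta_z2_z0_z1 K)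
    (fun '(k0, k1, k2) => if k1 == 0 then G k0 k2 else 0) (n0, n1, n2) l.
Proof.
case=> B hB; exists [seq ((i : nat)%:Z, n1, - n1 - 1 - i%:Z) | i <- iota 0 B].
case=> -[[i|i] m1] m2 /negP nin /=; last by rewrite scale0r.
rewrite subr_eq0; case: (n1 =P m1) => [e0|]; last by rewrite scaler0.
case: eqP => [e1|]; last by rewrite scale0r.
have [iB|Bi] := ltnP i B.
  by case: nin; apply/mapP; exists i; rewrite ?mem_iota // e1 e0.
have -> : n2 - m2 = n2 + n1 + 1 + i%:Z by rewrite e1 e0; lia.
by rewrite hB // scaler0.
Qed.
End DualJacobi.

Section DualJacobi2.
Variables (K : numFieldType) (V : voc K).
Notation D := (@voc_D K V).
Let Y (u : rdual V) (n : int) : rdual V -> rdual V := dual_mode (- n - 1) u.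

Lemma nat_above (M : int) : exists B : nat, forall i : nat, (B <= i)%N -> M < i%:Z.
Proof. by exists `|M|.+1 => i; lia. Qed.

Lemma ups_trunc v : exists N : int, forall n, N < n -> ups D n v = 0.
Proof.
have [N hN] := voc_truncated v; exists (- N - 1) => n nN; apply: hN; lia.
Qed.
Lemma Y_trunc u v : exists N : int, forall n, n < N -> Y u n v = 0.
Proof.
have [N hN] := dual_truncated u v; exists (- N - 1) => n nN; apply: hN; lia.
Qed.
Lemma Y_linear u n : linear (Y u n). Proof. exact: ((@dual_bilin K V (- n - 1)).2 u). Qed.
Lemma Y0l n v : Y 0 n v = 0.
Proof.
exact: (linear_eq0 ((@dual_bilin K V (- n - 1)).1 v)).
Qed.

Lemma dual_jacobi : voa_jacobi (V := dual_graded V) Y.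
Proof.
move=> u v w [[n0 n1] n2]; apply: rdual_ext => x.
have lu := rdual_linear u; have lv := rdual_linear v; have lw := rdual_linear w.
have luv := tpair_linear lu lv; have lvu := tpair_linear lv lu.
have lvw := tpair_linear lv lw; have luw := tpair_linear lu lw.
have lT := tpair_linear luv lw; have le := @rdual_ev_linear K V x.
have lid := @linear_id K V.
have lt1 n : linear (tmap id (ups D n)) := tmap_linear lid (@ups_linear K V n).
have lt2 n : linear (tmap (ups D n) id) := tmap_linear (@ups_linear K V n) lid.
have las := @tassoc_linear K V V V.
have lsw := tmap_linear (@tswap_linear K V V) lid.
have [N hN] := ups_trunc x.
have E1 : series_mul (@delta_z1_z2_z0 K) (Y_Y_uv (V := dual_graded V) Y u v w) (n0, n1, n2) x
    = tpair (tpair u v) w (series_mul (@delta_z1_z2_z0 K) (ups_id_ups D x) (n0, n1, n2)).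
  apply: (series_mul_transfer le lT).
  - apply: (@supp_z1_z2_z0 K (rdual V) (fun n1 n2 => Y u n1 (Y v n2 w))).
    have [M hM] := Y_trunc v w; have [B hB] := nat_above (n2 - M).
    by exists B => i /hB Bi; rewrite hM ?(linear_eq0 (@Y_linear _ _)) //; lia.
  - apply: (@supp_z1_z2_z0 K _ (fun n1 n2 => tassoc (tmap id (ups D n2) (ups D n1 x)))).
    have [B hB] := nat_above (N - n1 - n0 - 1); exists B => i /hB Bi.
    by rewrite hN ?(linear_eq0 (lt1 _)) ?(linear_eq0 las) //; lia.
  - case=> -[m0 m1] m2 /=; case: eqP => _; last by rewrite (linear_eq0 lT).
    by rewrite tpair_assoc // tpair_tmap //; exact: ups_linear.
have E2 : series_mul (@delta_z2_z1_z0 K) (Y_Y_vu (V := dual_graded V) Y u v w) (n0, n1, n2) x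
    = tpair (tpair u v) w (series_mul (@delta_z2_z1_z0 K) (ups_swap_ups D x) (n0, n1, n2)).
  apply: (series_mul_transfer le lT).
  - apply: (@supp_z2_z1_z0 K (rdual V) (fun n1 n2 => Y v n2 (Y u n1 w))).
    have [M hM] := Y_trunc u w; have [B hB] := nat_above (n1 - M).
    by exists B => i /hB Bi; rewrite hM ?(linear_eq0 (@Y_linear _ _)) //; lia.
  - apply: (@supp_z2_z1_z0 K _ (fun n1 n2 =>
      tmap (@tswap _ V V) id (tassoc (tmap id (ups D n1) (ups D n2 x))))).
    have [B hB] := nat_above (N - n2 - n0 - 1); exists B => i /hB Bi.
    by rewrite hN ?(linear_eq0 (lt1 _)) ?(linear_eq0 las) ?(linear_eq0 lsw) //; lia.
  - case=> -[m0 m1] m2 /=; case: eqP => _; last by rewrite (linear_eq0 lT).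
    rewrite tpair_tmap //; last exact: tswap_linear.
    have -> : tpair u v \o tswap (W:=V) = tpair v u by apply/funext => y; exact: tpair_swap.
    by rewrite tpair_assoc // tpair_tmap //; exact: ups_linear.
have E3 : series_mul (@delta_z1_z0_z2 K) (Y_Y_iter (V := dual_graded V) Y u v w) (n0, n1, n2) x
    = tpair (tpair u v) w (series_mul (@delta_z2_z0_z1 K) (ups_ups_id D x) (n0, n1, n2)).
  rewrite -delta_z2_z0_z1E; apply: (series_mul_transfer le lT).
  - apply: (@supp_z2_z0_z1 K (rdual V) (fun n0 n2 => Y (Y u n0 v) n2 w)).
    have [M hM] := Y_trunc u v; have [B hB] := nat_above (n0 - M).
    by exists B => i /hB Bi; rewrite hM ?Y0l //; lia.
  - apply: (@supp_z2_z0_z1 K _ (fun n0 n2 => tmap (ups D n0) id (ups D n2 x))).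
    have [B hB] := nat_above (N - n2 - n1 - 1); exists B => i /hB Bi.
    by rewrite hN ?(linear_eq0 (lt2 _)) //; lia.
  - case=> -[m0 m1] m2 /=; case: eqP => _; last by rewrite (linear_eq0 lT).
    by rewrite tpair_tmap //; exact: ups_linear.
have lB y z : tpair (tpair u v) w (y - z) = tpair (tpair u v) w y - tpair (tpair u v) w z.
  by have := lT (-1) z y; rewrite !scaleN1r [- z + y]addrC => ->; rewrite addrC.
by rewrite rdualD rdualN E1 E2 E3 -voc_jacobiP lB.
Qed.

Definition dual_voa : voa K := @Voa K (dual_graded V) (@dual_mode K V)
  (dual_vac V) (dual_omega V) (@dual_bilin K V) (@dual_truncated K V)
  (@dual_vacl K V) (@dual_vacr K V) dual_jacobi (@dual_vac0 K V) (@dual_omega2 K V)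
  (@dual_virasoro K V) (@dual_eigen K V) (@dual_deriv K V).
End DualJacobi2.

Section Morphisms.
Variable K : numFieldType.

Definition voc_automorphism (V : voc K) (g : V -> V) : Prop :=
  [/\ linear g, bijective g,
      forall v, voc_c V (g v) = voc_c V v,
      forall v, voc_rho V (g v) = voc_rho V v
    & forall n v, ups (@voc_D K V) n (g v) = tmap g g (ups (@voc_D K V) n v)].

Definition voc_derivation (V : voc K) (phi : V -> V) : Prop :=
  [/\ linear phi,
      forall v, voc_c V (phi v) = 0,
      forall v, voc_rho V (phi v) = 0
    & forall n v, ups (@voc_D K V) n (phi v) =
        tmap phi id (ups (@voc_D K V) n v) + tmap id phi (ups (@voc_D K V) n v)].

Definition voa_automorphism (W : voa K) (g : W -> W) : Prop :=
  [/\ linear g, bijective g,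
      g (voa_vac W) = voa_vac W,
      g (voa_omega W) = voa_omega W
    & forall u n v, g (voa_Y u n v) = voa_Y (g u) n (g v)].

Definition voa_derivation (W : voa K) (phi : W -> W) : Prop :=
  [/\ linear phi,
      phi (voa_vac W) = 0,
      phi (voa_omega W) = 0
    & forall u n v, phi (voa_Y u n v) = voa_Y (phi u) n v + voa_Y u n (phi v)].

(* The natural pairing of V' with V. *)
Definition pairing (V : voc K) (f : dual_voa V) (v : V) : K := @rdual_fun K V f v.
End Morphisms.

(* Main.v *)
Require Import Defs.
From mathcomp Require Import all_boot all_order all_algebra.
From mathcomp Require Import boolp classical_sets.
From mathcomp Require Import reals complex.

Set Implicit Arguments.
Unset Strict Implicit.
Unset Printing Implicit Defensive.

Import Order.TTheory GRing.Theory Num.Theory.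

Local Open Scope ring_scope.

(** Pairing V (x) V with V' (x) V' turns the coproduct Ups of V into the product
   Y of V', the counit c into the vacuum and rho into the conformal vector. So
   for a linear T : V -> V the condition that T respects (Ups, c, rho) and the
   condition that its transpose f |-> f \o T respects (Y, 1, omega) are the same
   equations, once read through the pairing. Two points need an argument.

   From V to V': the transpose must send the restricted dual V' to itself. An
   automorphism or derivation T respects rho and Ups, hence commutes with L(0)
   (automorphism_homog, derivation_homog); it then preserves the L(0)-eigenspaces
   V_s, and f \o T vanishes on almost all V_s when f does.

   From V' to V: an equality in V (x) V must follow from its pairings with
   V' (x) V'. This is tens_separates. Each V_s is finite-dimensional, so its
   linear functionals separate its points, whence V' separates the points of V
   (rdual_separates). A finite list of vectors of V then has a dual system in V'
   (rdual_frame), and contracting a tensor against that system expresses it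
   through scalars (u (x) w, x).

   The transposed statements are automorphism_transpose and
   derivation_transpose. The actions on V' in the theorem are the transposes of
   g^-1 and of - phi, and g^-1 (resp. - phi) is an automorphism (resp.
   derivation) exactly when g (resp. phi) is. *)

(** * Linear algebra *)

Section LinearE.
Variables (K : numFieldType) (U W : lmodType K).

Lemma linear_scaleE (f : U -> W) (lf : linear f) a u : f (a *: u) = a *: f u.
Proof. by have := lf a u 0; rewrite (linear_eq0 lf) !addr0. Qed.

Lemma linear_oppE (f : U -> W) (lf : linear f) u : f (- u) = - f u.
Proof. by rewrite -scaleN1r (linear_scaleE lf) scaleN1r. Qed.

Lemma linear_addE (f : U -> W) (lf : linear f) u v : f (u + v) = f u + f v.
Proof. by have := lf 1 u v; rewrite !scale1r. Qed.
End LinearE.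

Section SpanFunctional.
Variables (K : numFieldType) (V : lmodType K).

(** The span of a list, with one coefficient per step so that statements about
   it go by induction on the list. *)
Fixpoint lspan (e : seq V) (v : V) : Prop :=
  if e is x :: e' then exists a : K, lspan e' (v - a *: x) else v = 0.

Lemma lspan_sum (e : seq V) (a : nat -> K) :
  lspan e (\sum_(i < size e) a i *: e`_i).
Proof.
elim: e a => [|x e IH] a /=; first by rewrite big_ord0.
by exists (a 0%N); rewrite big_ord_recl /= addrC addKr; exact: (IH (a \o S)).
Qed.

Lemma lspan_lin e a u v : lspan e u -> lspan e v -> lspan e (a *: u + v).
Proof.
elim: e u v => [|x e IH] u v /=; first by move=> -> ->; rewrite scaler0 addr0.
move=> [b hb] [b' hb']; exists (a * b + b').
by rewrite scalerDl opprD addrACA -scalerA -scalerBr; apply: IH.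
Qed.

Lemma lspanZ e a u : lspan e u -> lspan e (a *: u).
Proof.
move=> hu; have h0 : lspan e 0.
  by have := lspan_lin (-1) hu hu; rewrite scaleN1r addNr.
by have := lspan_lin a hu h0; rewrite addr0.
Qed.

(** Linear functionals on a finitely generated space separate points. When the
   head x is not in the span of the tail e, every v in the span of x :: e is
   t v *: x + v' with v' in the span of e and t v unique, so t is linear; then either t or a functional
   of the component along e is nonzero at w. *)
Lemma lspan_functional (e : seq V) (w : V) : lspan e w -> w <> 0 ->
  exists2 f : V -> K,
    forall a u v, lspan e u -> lspan e v -> f (a *: u + v) = a * f u + f v
    & f w <> 0.
Proof.
elim: e w => [|x e IH] w //= hw w0.
have [xe|nxe] := pselect (lspan e x).
  have drop v : (exists a, lspan e (v - a *: x)) -> lspan e v.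
    by case=> a ha; have := lspan_lin a xe ha; rewrite addrC subrK.
  (* x brings nothing new: the spans of x :: e and of e coincide *)
  have [f hf fw] := IH w (drop w hw) w0.
  by exists f => // a u v /drop hu /drop hv; exact: hf.
pose t v : K := xget 0 [set a | lspan e (v - a *: x)]%classic.
have tP v : (exists a, lspan e (v - a *: x)) -> lspan e (v - t v *: x).
  by case=> a ha; have := @xgetI _ 0 [set a | lspan e (v - a *: x)]%classic a ha.
have tU v a : lspan e (v - a *: x) -> t v = a.
  move=> ha; have ht := tP v (ex_intro _ a ha); apply/eqP/negPn/negP => ne.
  (* two distinct coefficients would put a nonzero multiple of x in lspan e *)
  apply: nxe; have nz : a - t v != 0 by rewrite subr_eq0 eq_sym.
  have := lspanZ (a - t v)^-1 (lspan_lin (-1) ha ht).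
  rewrite scaleN1r opprB addrA subrK -scalerBl.
  by rewrite scalerA mulVf // scale1r.
have tlin a u v : (exists b, lspan e (u - b *: x)) ->
    (exists b, lspan e (v - b *: x)) -> t (a *: u + v) = a * t u + t v.
  move=> /tP hu /tP hv; apply: tU.
  by rewrite scalerDl opprD addrACA -scalerA -scalerBr; apply: lspan_lin.
have [tw|tw] := eqVneq (t w) 0; last by exists t => //; exact/eqP.
have hw' : lspan e w by have := tP w hw; rewrite tw scale0r subr0.
have [f hf fw] := IH w hw' w0.
exists (fun v => f (v - t v *: x)); last by rewrite tw scale0r subr0.
move=> a u v hu hv; rewrite tlin //.
rewrite scalerDl opprD addrACA -scalerA -scalerBr.
by apply: hf; exact: tP.
Qed.
End SpanFunctional.

(** * The restricted dual separates points and tensors *)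

Section Separation.
Variable K : numFieldType.

(** A nonzero w has a nonzero component in some V_s; a functional of the
   finite-dimensional V_s that is nonzero there extends to V' by composing it
   with the projection onto V_s. *)
Lemma rdual_separates (V : graded K) (w : V) :
  (forall f : rdual V, f w = 0) -> w = 0.
Proof.
move=> hw; have [r _ ->] := gproj_sum w; apply: big1 => s _.
apply: contrapT => ns; have [e he] := @gfindim K V s.
have lsp v : homog s v -> lspan e v by move=> /he[a ->]; exact: lspan_sum.
have hp v := @gproj_homog K V s v.
have [f hf fn] := lspan_functional (lsp _ (hp w)) ns.
have lfg : linear (f \o gproj V s : V -> K^o).
  by move=> a u v; rewrite /= linearP hf //; exact: lsp.
have mf : (f \o gproj V s : V -> K^o) \in @rdual_pred K V.
  apply/asboolP; split=> //; exists [:: s] => t v; rewrite inE => ts hv.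
  rewrite /= (gproj_eq _ hv) eq_sym (negbTE ts).
  by have := linear_eq0 lfg; rewrite /= linear0.
exact/fn/(hw (RDual mf)).
Qed.

(** A finite-rank endomorphism of V, with functionals taken in V', that fixes a
   given finite list: this plays the role of a dual basis, without asking the
   list to be independent. To make an endomorphism P that fixes e fix x as well,
   when w = x - P x is nonzero, choose f in V' with f w nonzero and add the
   rank-one map v |-> (f (v - P v) / f w) w, which vanishes where P v = v. *)
Lemma rdual_frame (V : graded K) (e : seq V) :
  exists r : seq (rdual V * V),
    forall v, v \in e -> \sum_(p <- r) (p.1 v : K) *: p.2 = v.
Proof.
elim: e => [|x e [r hr]]; first by exists [::].
pose P v := \sum_(p <- r) (p.1 v : K) *: p.2.
have [wx|/eqP nw] := eqVneq (x - P x) 0.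
  exists r => v; rewrite inE => /predU1P[->|/hr //].
  by apply/esym/eqP; rewrite -subr_eq0 wx.
have [f /eqP fw] : exists f : rdual V, f (x - P x) <> 0.
  apply: contrapT => nf; apply: nw; apply: rdual_separates => f.
  by apply: contrapT => nfx; apply: nf; exists f.
pose k : K := f (x - P x).
pose f' : rdual V := k^-1 *: (f - \sum_(p <- r) (f p.2 : K) *: p.1).
have f'E v : f' v = k^-1 * f (v - P v).
  rewrite /f' rdualZ rdualD rdualN (linear_sumE _ _ (rdual_ev_linear v)).
  rewrite -[_ *: _]/(_ * _); congr (_ * _).
  have lf := rdual_linear f.
  rewrite (linear_addE lf) (linear_oppE lf); congr (_ - _); rewrite /P (linear_sumE _ _ lf).
  by apply: eq_bigr => p _; rewrite (linear_scaleE lf) rdualZ; exact: mulrC.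
exists ((f', x - P x) :: r) => v; rewrite big_cons [(_, _).1]/= [(_, _).2]/= -/(P v) f'E.
rewrite inE => /predU1P[->|/hr hv]; first by rewrite mulVf // scale1r subrK.
by rewrite /P hv subrr (linear_eq0 (rdual_linear f)) mulr0 scale0r add0r.
Qed.

(** Let z = x - y. Write z = sum_l a_l (x) b_l and take a frame (p_i, e_i) fixing all the a_l.
   Then z = sum_i e_i (x) (p_i (x) Id) z, and each (p_i (x) Id) z vanishes
   because every w in W' maps it to (p_i (x) w, z) = 0. *)
Lemma tens_separates (U W : graded K) (x y : tensor U W) :
  (forall (u : rdual U) (w : rdual W), tpair u w x = tpair u w y) -> x = y.
Proof.
move=> xy; apply/eqP; rewrite -subr_eq0; apply/eqP.
have {xy} : forall (u : rdual U) (w : rdual W), tpair u w (x - y) = 0.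
  move=> u w; have l := tpair_linear (rdual_linear u) (rdual_linear w).
  by rewrite (linear_addE l) (linear_oppE l) xy subrr.
move: (x - y) => {x y}; move=> z hz.
have [t2l t2r] := @tens_bilin K U W.
have [l zE] := tens_sum z; have [r hr] := rdual_frame [seq p.1 | p <- l].
have lc (p : rdual U * U) := contrl_linear (W := W) (rdual_linear p.1).
have -> : z = \sum_(p <- r) tens p.2 (contrl p.1 z).
  rewrite [in RHS]zE; under eq_bigr => p _.
    rewrite (linear_sumE _ _ (lc p)) (linear_sumE _ _ (t2r p.2)); over.
  rewrite exchange_big {1}zE; apply: eq_big_seq => q ql /=.
  rewrite -[in LHS](hr q.1 (map_f _ ql)) (linear_sumE _ _ (t2l q.2)).
  apply: eq_bigr => p _; rewrite contrlE; last exact: rdual_linear.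
  by rewrite (linear_scaleE (t2l _)) (linear_scaleE (t2r _)).
apply: big1 => p _; rewrite (_ : contrl p.1 z = 0) ?(linear_eq0 (t2r _)) //.
apply: rdual_separates => w.
by rewrite tpair_contrl ?hz //; exact: rdual_linear.
Qed.
End Separation.

(** * Transposition *)

Section Transpose.
Variables (K : numFieldType) (V : voc K).
Notation c := (voc_c V : V -> K^o).
Notation rho := (voc_rho V : V -> K^o).
Notation D := (@voc_D K V).

Lemma contrl_tmap (U W X Z : lmodType K) (g : U -> X) (h : W -> Z)
    (f : X -> K^o) x : linear g -> linear h -> linear f ->
  contrl f (tmap g h x) = h (contrl (f \o g) x).
Proof.
move=> lg lh lf; have lfg := linear_comp lg lf.
apply: (@tens_linear_eq _ _ _ _ (contrl f \o tmap g h) (h \o contrl (f \o g))).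
- exact: linear_comp (tmap_linear lg lh) (contrl_linear lf).
- exact: linear_comp (contrl_linear lfg) lh.
- move=> u w; rewrite /= tmapE // !contrlE //=.
  exact/esym/linear_scaleE.
Qed.

Lemma homog_commute (T : V -> V) : linear T ->
  (forall v, voc_L 0 (T v) = T (voc_L 0 v)) ->
  forall s v, homog s v -> homog s (T v).
Proof.
move=> lT hT s v /voc_eigen hv; apply/voc_eigen; rewrite hT hv.
exact: linear_scaleE.
Qed.

(** Naturality of L(0) = (rho (x) Id) D_1: as g respects D_1 and rho, it commutes
   with L(0). *)
Lemma automorphism_homog (g : V -> V) : voc_automorphism g ->
  forall s v, homog s v -> homog s (g v).
Proof.
case=> lg _ _ gr gD; apply: homog_commute => // v.
have lr : linear rho := @voc_rho_linear K V.
rewrite /voc_L gD (contrl_tmap _ lg lg lr).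
by congr (g (contrl _ _)); apply/funext => w; exact: gr.
Qed.

(** Applying rho (x) Id to the Leibniz rule gives
   L(0) phi = (rho \o phi (x) Id) D_1 + phi L(0), where rho \o phi = 0. *)
Lemma derivation_homog (phi : V -> V) : voc_derivation phi ->
  forall s v, homog s v -> homog s (phi v).
Proof.
case=> lp _ pr pD; apply: homog_commute => // v.
have lr : linear rho := @voc_rho_linear K V.
have lid := @linear_id K V.
have lc := contrl_linear (W := V) lr.
rewrite /voc_L pD (linear_addE lc).
rewrite (contrl_tmap _ lp lid lr) (contrl_tmap _ lid lp lr).
have -> : rho \o phi = (fun=> 0) by apply/funext => w; exact: pr.
have l0 : linear ((fun=> 0) : V -> K^o) by move=> a u w; rewrite scaler0 addr0.
suff -> : contrl ((fun=> 0) : V -> K^o) (ups D (0 - 2) v) = 0 :> V by rewrite add0r.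
have [l ->] := tens_sum (ups D (0 - 2) v).
rewrite (linear_sumE _ _ (contrl_linear l0)) big1 // => p _.
by rewrite contrlE // scale0r.
Qed.

Lemma rdual_comp_subproof (T : V -> V) : linear T ->
  (forall s v, homog s v -> homog s (T v)) ->
  forall f : rdual V, (f \o T : V -> K^o) \in @rdual_pred K V.
Proof.
move=> lT hT f; apply/asboolP; split; first exact: linear_comp lT (rdual_linear f).
by have [r hr] := rdual_finite f; exists r => s v sr /hT; exact: hr.
Qed.

Lemma pairing_Y (u v : dual_voa V) n x :
  pairing (voa_Y u n v) x = tpair (pairing u) (pairing v) (ups D n x).
Proof. by []. Qed.

Lemma pairing_vac v : pairing (voa_vac (dual_voa V)) v = c v.
Proof. exact: voc_c_proj. Qed.

Lemma pairing_omega v : pairing (voa_omega (dual_voa V)) v = rho v.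
Proof. exact: voc_rho_proj. Qed.

Lemma pairing_linear (f : dual_voa V) : linear (pairing f : V -> K^o).
Proof. exact: rdual_linear. Qed.

Lemma pairing_ext (f g : dual_voa V) : pairing f =1 pairing g -> f = g.
Proof. exact: rdual_ext. Qed.

Lemma linear_cancel (g ginv : V -> V) : linear g -> cancel g ginv -> cancel ginv g ->
  linear ginv.
Proof. by move=> lg gK gK' a u v; rewrite -[u in LHS]gK' -[v in LHS]gK' -lg gK. Qed.

Lemma tmap_cancel (g ginv : V -> V) : linear g -> linear ginv -> cancel g ginv ->
  cancel (tmap g g) (tmap ginv ginv).
Proof.
move=> lg lh gK.
apply: (@tens_linear_eq _ _ _ _ (tmap ginv ginv \o tmap g g) id).
- exact: linear_comp (tmap_linear lg lg) (tmap_linear lh lh).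
- exact: linear_id.
- by move=> u w; rewrite /= !tmapE // !gK.
Qed.

Lemma automorphism_inv (g ginv : V -> V) : cancel g ginv -> cancel ginv g ->
  voc_automorphism g -> voc_automorphism ginv.
Proof.
move=> gK gK' [lg _ gc gr gD]; have lh := linear_cancel lg gK gK'.
split=> //; first by exists g.
- by move=> v; rewrite -gc gK'.
- by move=> v; rewrite -gr gK'.
- by move=> n v; rewrite -[v in RHS]gK' gD (tmap_cancel lg lh gK).
Qed.

(** In both directions (Y(u,z) v, T x) and (Y(u \o T,z) (v \o T), x) are
   (u (x) v, Ups(z) T x) and (u (x) v, (T (x) T) Ups(z) x). *)
Lemma automorphism_transpose (T S : V -> V) : linear T -> cancel T S -> cancel S T ->
  voc_automorphism T <->
  exists h : dual_voa V -> dual_voa V,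
    (forall f v, pairing (h f) v = pairing f (T v)) /\ voa_automorphism h.
Proof.
move=> lT TK SK; split.
  move=> aT; have aS := automorphism_inv TK SK aT; have lS := linear_cancel lT TK SK.
  pose h f : dual_voa V := RDual (rdual_comp_subproof lT (automorphism_homog aT) f).
  pose k f : dual_voa V := RDual (rdual_comp_subproof lS (automorphism_homog aS) f).
  have hE (f : dual_voa V) v : pairing (h f) v = pairing f (T v) by [].
  have kE (f : dual_voa V) v : pairing (k f) v = pairing f (S v) by [].
  have [_ _ Tc Tr TD] := aT; exists h; split=> //; split.
  - by move=> a f f'; apply: pairing_ext => v.
  - by exists k => f; apply: pairing_ext => v; rewrite ?hE ?kE ?hE ?TK ?SK.
  - by apply: pairing_ext => v; rewrite hE !pairing_vac; exact: Tc.
  - by apply: pairing_ext => v; rewrite hE !pairing_omega; exact: Tr.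
  - move=> u n v; apply: pairing_ext => x; rewrite hE !pairing_Y TD.
    by rewrite tpair_tmap //; exact: pairing_linear.
case=> h [hE [_ _ h1 hw hY]]; split=> //; first by exists S.
- by move=> v; have := congr1 (fun f => pairing f v) h1; rewrite hE !pairing_vac.
- by move=> v; have := congr1 (fun f => pairing f v) hw; rewrite hE !pairing_omega.
- move=> n x; apply: tens_separates => u v.
  have lu := pairing_linear u; have lv := pairing_linear v.
  have := congr1 (fun f => pairing f x) (hY u n v).
  rewrite hE !pairing_Y => ->; rewrite (tpair_tmap _ lT lT lu lv).
  by congr tpair; apply/funext => y; rewrite hE.
Qed.

(** Both sides of the Leibniz rule are linear in phi. *)
Lemma derivation_opp (phi : V -> V) : voc_derivation phi ->
  voc_derivation (fun v => - phi v).
Proof.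
case=> lp pc pr pD.
have lo : linear (fun v => - phi v).
  by move=> a u v; rewrite lp opprD scalerN.
have lid := @linear_id K V; have [t2l t2r] := @tens_bilin K V V.
have tN1 (x : tensor V V) : tmap (fun v => - phi v) id x = - tmap phi id x.
  apply: (@tens_linear_eq _ _ _ _ (tmap (fun v => - phi v) id) (-%R \o tmap phi id)).
  - exact: tmap_linear.
  - by move=> a y z; rewrite /= (tmap_linear lp lid) opprD scalerN.
  - move=> u w; rewrite /= !tmapE //.
    exact: (linear_oppE (t2l w)).
have tN2 (x : tensor V V) : tmap id (fun v => - phi v) x = - tmap id phi x.
  apply: (@tens_linear_eq _ _ _ _ (tmap id (fun v => - phi v)) (-%R \o tmap id phi)).
  - exact: tmap_linear.
  - by move=> a y z; rewrite /= (tmap_linear lid lp) opprD scalerN.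
  - move=> u w; rewrite /= !tmapE //.
    exact: (linear_oppE (t2r u)).
split=> //.
- by move=> v; rewrite linearN pc oppr0.
- by move=> v; rewrite linearN pr oppr0.
- by move=> n v; rewrite tN1 tN2 -opprD -pD /ups linearN.
Qed.

(** Pairing u (x) v with the Leibniz rule for T puts u \o T and v \o T in the
   two factors with no change of sign; the sign in the action of a derivation on
   V' is accounted for by derivation_opp. *)
Lemma derivation_transpose (T : V -> V) : linear T ->
  voc_derivation T <->
  exists psi : dual_voa V -> dual_voa V,
    (forall f v, pairing (psi f) v = pairing f (T v)) /\ voa_derivation psi.
Proof.
move=> lT; have lid := @linear_id K V; split.
  move=> dT; pose psi f : dual_voa V :=
    RDual (rdual_comp_subproof lT (derivation_homog dT) f).
  have psiE (f : dual_voa V) v : pairing (psi f) v = pairing f (T v) by [].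
  have [_ Tc Tr TD] := dT; exists psi; split=> //; split.
  - by move=> a f f'; apply: pairing_ext => v.
  - by apply: pairing_ext => v; rewrite psiE pairing_vac; exact: Tc.
  - by apply: pairing_ext => v; rewrite psiE pairing_omega; exact: Tr.
  - move=> u n v; apply: pairing_ext => x.
    have lu := pairing_linear u; have lv := pairing_linear v.
    transitivity (pairing (voa_Y (psi u) n v) x + pairing (voa_Y u n (psi v)) x); last by [].
    rewrite psiE !pairing_Y TD (linear_addE (tpair_linear lu lv)).
    by rewrite (tpair_tmap _ lT lid lu lv) (tpair_tmap _ lid lT lu lv).
case=> psi [psiE [_ h1 hw hY]]; split=> //.
- by move=> v; have := congr1 (fun f => pairing f v) h1; rewrite psiE pairing_vac.
- by move=> v; have := congr1 (fun f => pairing f v) hw; rewrite psiE pairing_omega.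
- move=> n x; apply: tens_separates => u v.
  have lu := pairing_linear u; have lv := pairing_linear v.
  have psiC (f : dual_voa V) : pairing (psi f) = pairing f \o T.
    by apply/funext => y; exact: psiE.
  have := congr1 (fun f => pairing f x) (hY u n v).
  rewrite psiE pairing_Y => ->.
  rewrite [RHS](linear_addE (tpair_linear lu lv)) (tpair_tmap _ lT lid lu lv) (tpair_tmap _ lid lT lu lv).
  by rewrite -!psiC.
Qed.
End Transpose.

Theorem proposition3p2 (R : realType) (V : voc R[i]) :
  (forall (g : {linear V -> V}) (ginv : V -> V), cancel g ginv -> cancel ginv g ->
     voc_automorphism g <->
     exists h : dual_voa V -> dual_voa V,
       (forall (f : dual_voa V) (v : V), pairing (h f) v = pairing f (ginv v))
       /\ voa_automorphism h)
  /\
  (forall phi : {linear V -> V},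
     voc_derivation phi <->
     exists psi : dual_voa V -> dual_voa V,
       (forall (f : dual_voa V) (v : V), pairing (psi f) v = pairing f (- phi v))
       /\ voa_derivation psi).
Proof.
split=> [g ginv gK gK'|phi].
  have lg : linear g := @linearP _ _ _ _ g.
  rewrite -(automorphism_transpose (linear_cancel lg gK gK') gK' gK).
  by split; apply: automorphism_inv.
have lN : linear (fun v => - phi v) by move=> a u v; rewrite linearP opprD scalerN.
rewrite -(derivation_transpose lN); split=> [|/derivation_opp]; first exact: derivation_opp.
by congr voc_derivation; apply/funext => v; rewrite opprK.
Qed.
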